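(* Let $L$ be a finite dimensional Lie algebra over a field $k$ of characteristic zero, and let $R(L)$ be the solvable radical of $L$. Then $R(L)$ coincides with the set of all elements $y\in L$ having the following property: for every $x\in L$ the Lie subalgebra of $L$ generated by $x$ and $y$ is solvable.
   Context: The solvable radical $R(L)$ of a finite dimensional Lie algebra $L$ is the maximal solvable ideal of $L$. *)

(* Defs.v *)
From HB Require Import structures.
From mathcomp Require Import all_boot all_algebra boolp.

Set Implicit Arguments.
Unset Strict Implicit.
Unset Printing Implicit Defensive.

Import GRing.Theory.

Local Open Scope ring_scope.

HB.mixin Record Lmodule_isLie (k : fieldType) L of GRing.Lmodule k L := {
  lie : L -> L -> L;
  lie_is_linear_l : forall y, linear (lie^~ y);
  lie_is_linear_r : forall x, linear (lie x);
  liexx : forall x, lie x x = 0;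
  lie_jacobi : forall x y z,
    lie x (lie y z) + lie y (lie z x) + lie z (lie x y) = 0
}.

(* Lie algebras are finite dimensional here, since vectType is. *)
#[short(type="lieAlgType")]
HB.structure Definition LieAlgebra (k : fieldType) :=
  {L of Vector k L & Lmodule_isLie k L}.

Section LieTheory.
Variables (k : fieldType) (L : lieAlgType k).
Implicit Types (x y z : L) (U V W I J : {vspace L}) (X : seq L).

Definition liev U V : {vspace L} := <<allpairs lie (vbasis U) (vbasis V)>>%VS.

Definition is_subalgebra U : Prop := {in U & U, forall x y, lie x y \in U}.

Definition is_ideal I : Prop := forall x y, y \in I -> lie x y \in I.

(* The subspaces U of interest are subalgebras, in which case every term of   *)
(* the derived series is contained in the preceding one.                      *)
Definition derived_series n U : {vspace L} := iter n (fun V => liev V V) U.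

Definition solvable_lie U : Prop := exists n, derived_series n U = 0%VS.

Definition is_solvable_ideal I : Prop := is_ideal I /\ solvable_lie I.

(* "Maximal" means largest: every solvable ideal of L is contained in I.      *)
Definition is_solvable_radical I : Prop :=
  is_solvable_ideal I /\ forall J, is_solvable_ideal J -> (J <= I)%VS.

Definition is_generated_subalgebra X U : Prop :=
  [/\ is_subalgebra U, {subset X <= U} &
      forall V, is_subalgebra V -> {subset X <= V} -> (U <= V)%VS].

Definition lier y x := lie x y.

HB.instance Definition _ y :=
  GRing.isLinear.Build k L L _ (lier y) (@lie_is_linear_l k L y).
HB.instance Definition _ x :=
  GRing.isLinear.Build k L L _ (lie x) (@lie_is_linear_r k L x).

Lemma lieDl x y z : lie (x + y) z = lie x z + lie y z.
Proof. exact: (raddfD (lier z)). Qed.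

Lemma lieDr x y z : lie x (y + z) = lie x y + lie x z.
Proof. exact: raddfD. Qed.

Lemma lieZl a x y : lie (a *: x) y = a *: lie x y.
Proof. exact: (linearZ_LR (lier y)). Qed.

Lemma lieZr a x y : lie x (a *: y) = a *: lie x y.
Proof. exact: linearZ_LR. Qed.

Lemma lie_suml n (F : 'I_n -> L) y :
  lie (\sum_i F i) y = \sum_i lie (F i) y.
Proof. exact: (linear_sum (lier y)). Qed.

Lemma lie_sumr n x (F : 'I_n -> L) :
  lie x (\sum_i F i) = \sum_i lie x (F i).
Proof. exact: linear_sum. Qed.

Lemma lie_antisym x y : lie x y = - lie y x.
Proof.
apply/eqP; rewrite -addr_eq0; apply/eqP.
by have := liexx (x + y); rewrite lieDl !lieDr !liexx add0r addr0.
Qed.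

Lemma memv_lie U V : {in U & V, forall x y, lie x y \in liev U V}.
Proof.
move=> x y Ux Vy; rewrite (coord_vbasis Ux) (coord_vbasis Vy).
rewrite lie_suml memv_suml // => i _.
rewrite lieZl memvZ // lie_sumr memv_suml // => j _.
rewrite lieZr memvZ // memv_span //; apply/allpairsP.
by exists ((vbasis U)`_i, (vbasis V)`_j); rewrite /= !mem_nth ?size_tuple.
Qed.

Lemma lievP U V W :
  reflect {in U & V, forall x y, lie x y \in W} (liev U V <= W)%VS.
Proof.
apply: (iffP idP) => [/subvP sUVW x y Ux Vy | sUVW].
  exact/sUVW/memv_lie.
apply/span_subvP=> _ /allpairsP[[x y] /= [Ux Vy ->]].
by apply: sUVW; apply: vbasis_mem.
Qed.

Lemma lievS U1 U2 V1 V2 :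
  (U1 <= U2 -> V1 <= V2 -> liev U1 V1 <= liev U2 V2)%VS.
Proof.
move=> /subvP sU /subvP sV; apply/lievP => x y /sU Ux /sV Vy.
exact: memv_lie.
Qed.

Lemma derived_seriesS n U V :
  (U <= V)%VS -> (derived_series n U <= derived_series n V)%VS.
Proof. by move=> sUV; elim: n => //= n IHn; apply: lievS. Qed.

Lemma solvable_ideal0 : is_solvable_ideal 0%VS.
Proof.
split; last by exists 0%N.
by move=> x y; rewrite memv0 => /eqP->; rewrite raddf0 mem0v.
Qed.

Lemma derived_series_addv_ideal n U J :
  is_ideal J -> (derived_series n (U + J) <= derived_series n U + J)%VS.
Proof.
move=> idJ; elim: n => //= n IHn.
apply: subv_trans (lievS IHn IHn) _; apply/lievP => p q.
move=> /memv_addP[a Da [b Jb ->]] /memv_addP[c Dc [d Jd ->]].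
rewrite lieDl lieDr -addrA memv_add ?memv_lie // memvD //; first exact: idJ.
by rewrite lie_antisym memvN idJ.
Qed.

Lemma solvable_idealD I J :
  is_solvable_ideal I -> is_solvable_ideal J -> is_solvable_ideal (I + J)%VS.
Proof.
move=> [idI [n solI]] [idJ [m solJ]]; split.
  move=> x y /memv_addP[a Ia [b Jb ->]].
  by rewrite lieDr memv_add ?idI ?idJ.
exists (m + n)%N; apply/eqP; rewrite -subv0 -solJ.
rewrite {1}/derived_series iterD; apply: derived_seriesS.
by have := derived_series_addv_ideal n I idJ; rewrite solI add0v.
Qed.

Lemma ex_solvable_radical : exists I, is_solvable_radical I.
Proof.
pose P n := `[< exists I, is_solvable_ideal I /\ \dim I = n >].
have exP : exists n, P n.
  by exists 0%N; apply/asboolP; exists 0%VS; rewrite dimv0; split=> //;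
     apply: solvable_ideal0.
have ubP n : P n -> (n <= \dim {:L})%N.
  by move=> /asboolP[I [_ <-]]; rewrite dimvS ?subvf.
case: (ex_maxnP exP ubP) => n /asboolP[I [solI dimI]] maxI.
exists I; split=> // J solJ.
have/maxI : P (\dim (I + J)) by apply/asboolP; exists (I + J)%VS;
  split=> //; apply: solvable_idealD.
rewrite -dimI => leIJ.
have /eqP-> : I == (I + J)%VS by rewrite eqEdim addvSl.
exact: addvSr.
Qed.

Lemma ex_generated_subalgebra X : exists U, is_generated_subalgebra X U.
Proof.
pose P n :=
  `[< exists U, [/\ is_subalgebra U, {subset X <= U} & \dim U = n] >].
have exP : exists n, P n.
  exists (\dim {:L}); apply/asboolP; exists fullv.
  by split=> // [x y|x] *; rewrite memvf.
case: (ex_minnP exP) => n /asboolP[U [algU sXU dimU]] minU.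
exists U; split=> // V algV sXV.
have/minU : P (\dim (U :&: V)).
  apply/asboolP; exists (U :&: V)%VS; split=> // [x y|x Xx].
    by rewrite !memv_cap => /andP[Ux Vx] /andP[Uy Vy]; rewrite algU ?algV.
  by rewrite memv_cap sXU ?sXV.
rewrite -dimU => leUV.
have /eqP<- : (U :&: V)%VS == U by rewrite eqEdim capvSl.
exact: capvSr.
Qed.

Definition solvable_radical : {vspace L} := sval (cid ex_solvable_radical).

Definition generated_subalgebra X : {vspace L} :=
  sval (cid (ex_generated_subalgebra X)).

Lemma solvable_radicalP : is_solvable_radical solvable_radical.
Proof. exact: svalP (cid ex_solvable_radical). Qed.

Lemma generated_subalgebraP X :
  is_generated_subalgebra X (generated_subalgebra X).
Proof. exact: svalP (cid (ex_generated_subalgebra X)). Qed.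

End LieTheory.

Arguments solvable_radical {k} L.

(* Main.v *)
From HB Require Import structures.
Require Import Defs.
From mathcomp Require Import all_boot all_order all_algebra all_field.
From mathcomp Require Import boolp ring.

(******************************************************************************)
(* If [y] is in the radical [R], then [<x, y>] lies in [k x + R], whose       *)
(* derived algebra lies in [R]. Conversely, in characteristic zero the        *)
(* derived algebra of the solvable algebra [<x, y>] acts nilpotently on [L],  *)
(* so [B([x, y], [x, y]) = 0] for all [x], where [B] is the trace form of the *)
(* action on [L / R]. Polarizing in [x] and using the invariance of [B] puts  *)
(* every [[y, [x, y]]] in the kernel of [B], which lies in [R] by Cartan's    *)
(* criterion. Writing [X], [Y] for the actions of [x], [y] on [L / R], this   *)
(* yields [Y Y = 0] and [2 Y X Y = 0], so [Y X] squares to zero, hence        *)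
(* [B(y, x) = 0] for all [x], and [y] is in [R] by Cartan's criterion again.  *)
(* The field need not be algebraically closed: instead of Lie's theorem, the  *)
(* first step takes traces on minimal invariant sections of [L], and a        *)
(* splitting field is only used in Cartan's criterion, for one matrix.        *)
(******************************************************************************)

Set Implicit Arguments.
Unset Strict Implicit.
Unset Printing Implicit Defensive.

Import Order.TTheory GRing.Theory Num.Theory.

Local Open Scope ring_scope.

(** * Traces and nilpotency *)

(** Two classical results, over any field of characteristic zero, carry the converse direction.

    [solvable_derived_nilpotent]: on a minimal invariant section of [L], an ideal of the solvable
    algebra acting by commuting nilpotent maps has an invariant common kernel, so it acts by zero;
    the nilpotency itself is read off from the traces of powers ([mx_nilpotent_trace]).

    [trace_form_kernel_sub_radical]: let [J] be the kernel of the trace form on [L / R]. Elements of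
    [[L, J]] act by matrices [c] orthogonal to every matrix normalizing the image of [L]. Replacing
    each eigenvalue [a] of [c] by an integer [F a] that respects the integral relations among
    eigenvalues gives a matrix whose commutator map is a polynomial in that of [c]
    ([commx_poly_act]). Orthogonality to it weights [a] by [F a] and its multiplicity with total
    zero, and enough [F] force all eigenvalues to vanish ([int_functionals_separate]). So [[L, J]]
    acts nilpotently on [L / R], [solvable_of_nilpotent_action] puts it inside [R], and [J] follows
    because [L / R] has no centre. *)

Lemma vspace_comprehension (K : fieldType) (V : vectType K) (P : V -> Prop) :
    P 0 -> (forall a u v, P u -> P v -> P (a *: u + v)) ->
  exists U : {vspace V}, forall v, v \in U <-> P v.
Proof.
move=> P0 Plin.
(* A subspace of largest dimension inside [P] contains every [v] with [P v], since adding the line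
   of [v] stays inside [P]. *)
pose Q n :=
  `[< exists U : {vspace V}, (forall v, v \in U -> P v) /\ \dim U = n >].
have exQ : exists n, Q n.
  exists 0; apply/asboolP; exists 0%VS; rewrite dimv0; split=> // v.
  by rewrite memv0 => /eqP->.
have ubQ n : Q n -> (n <= \dim {:V})%N.
  by move=> /asboolP[U [_ <-]]; rewrite dimvS ?subvf.
case: (ex_maxnP exQ ubQ) => n /asboolP[U [UP dimU]] maxU.
exists U => v; split=> [/UP // | Pv].
have/maxU : Q (\dim (U + <[v]>)).
  apply/asboolP; exists (U + <[v]>)%VS; split=> // w.
  move=> /memv_addP[u Uu [_ /vlineP[a ->] ->]].
  by rewrite addrC; apply: Plin => //; apply: UP.
rewrite -dimU => leU.
have /eqP-> : U == (U + <[v]>)%VS by rewrite eqEdim addvSl.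
by apply: (subvP (addvSr _ _)); apply: memv_line.
Qed.

(** Factoring [X ^+ m - A' ^+ m] by [X - A'] and taking determinants shows that the characteristic
    polynomial divides a power of ['X]; being monic it is a power of ['X], with no subleading
    coefficient. *)
Lemma mxtrace_nilpotent (K : fieldType) n (A : 'M[K]_n) m :
  A ^+ m = 0 -> \tr A = 0.
Proof.
case: n A => [|n] A Am0; first by rewrite /mxtrace big_ord0.
pose X : 'M[{poly K}]_n.+1 := 'X%:M; pose A' := map_mx (@polyC K) A.
have cXA : GRing.comm X A' by apply: comm_scalar_mx.
have : char_poly A %| ('X - 0%:P) ^+ (n.+1 * m).
  apply/dvdpP; exists (\det (\sum_(i < m) X ^+ (m.-1 - i) * A' ^+ i)).
  rewrite mulrC -det_mulmx -[char_poly_mx A]/(X - A') -[_ *m _]subrXX_comm //.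
  have -> : A' ^+ m = 0.
    by rewrite -(rmorphXn (map_mx (@polyC K))) Am0 /= map_mx0.
  rewrite subr0; by rewrite subr0 /X -rmorphXn /= det_scalar -exprM mulnC.
case/dvdp_exp_XsubCP => j [_]; rewrite subr0.
rewrite eqp_monic ?char_poly_monic ?monicXn // => /eqP eqX.
have /eqP : size (char_poly A) = n.+2 by rewrite size_char_poly.
rewrite eqX size_polyXn eqSS => /eqP jE.
apply: oppr_inj.
by rewrite -char_poly_trace // eqX jE coefXn /= ltn_eqF ?oppr0.
Qed.

(** In a rank factorization [A = C R], idempotency forces [R C = 1], and [C R] and [R C] have the
    same trace. *)
Lemma mxtrace_idempotent (K : fieldType) n (A : 'M[K]_n) :
  A *m A = A -> \tr A = (\rank A)%:R.
Proof.
move=> AA; suff RC1 : row_base A *m col_base A = 1%:M.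
  by rewrite -{1}[A]mulmx_base mxtrace_mulC RC1 mxtrace1.
apply: (row_full_inj (col_base_full A)).
apply: (row_free_inj (row_base_free A)).
by rewrite /= mulmx1 (mulmxA (col_base A)) mulmx_base -mulmxA !mulmx_base.
Qed.

(* Otherwise some polynomial in [A] without constant term is a nonzero        *)
(* idempotent (Fitting), whose trace is its rank.                             *)
Lemma mx_nilpotent_trace (K : fieldType) n (A : 'M[K]_n) :
    [pchar K] =i pred0 -> (forall i, \tr (A ^+ i.+1) = 0) ->
  exists m, A ^+ m = 0.
Proof.
case: n A => [|n] A char0 trA; first by exists 1%N; apply: thinmx0.
have [m [q]] := multiplicity_XsubC (char_poly A) 0.
rewrite monic_neq0 ?char_poly_monic //= subr0 => q0 Dchar.
(* The exponent [m.+1] rather than [m] ensures that [p] below has no constant term even when [m] is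
   zero, so that the trace of [p(A)] only involves positive powers of [A]. *)
have /Bezout_eq1_coprimepP[[u v] /= uv1] : coprimep q ('X^(m.+1)).
  by apply: coprimep_expr; rewrite -['X]subr0 -polyC0 coprimep_XsubC.
have CH : horner_mx A (q * 'X^(m.+1)) = 0.
  by rewrite exprSr mulrA -Dchar rmorphM /= Cayley_Hamilton mul0r.
pose p := v * 'X^(m.+1); pose e := horner_mx A p.
have ee : e *m e = e.
  apply/eqP; rewrite -subr_eq0 -[e *m e]rmorphM -rmorphB /=.
  have -> : p * p - p = - (u * v) * (q * 'X^(m.+1)).
    have pB1 : p - 1 = - (u * q) by rewrite -uv1 opprD addrCA subrr addr0.
    by rewrite -{3}[p]mulr1 -mulrBr pB1 /p; ring.
  by rewrite rmorphM /= CH mulr0.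
have e0 : e = 0.
  apply/eqP; rewrite -mxrank_eq0.
  have : \tr e = 0.
    rewrite /e /p mulrC exprS -mulrA mulrC; set w := _ * v.
    have -> : w * 'X = \sum_(i < size w) w`_i *: 'X^(i.+1).
      rewrite -{1}[w]coefK poly_def mulr_suml; apply: eq_bigr => i _.
      by rewrite -scalerAl -exprSr.
    rewrite !linear_sum big1 // => i _.
    by rewrite linearZ /= rmorphXn /= horner_mx_X linearZ /= trA mulr0.
  by rewrite (mxtrace_idempotent ee) => /eqP; move/pcharf0P: char0 => ->.
exists m.+1.
have: horner_mx A (u * q + v * 'X^(m.+1)) = 1 by rewrite uv1 rmorph1.
rewrite rmorphD /= -/p -/e e0 addr0 => uq1.
rewrite -[LHS]mul1r -uq1 -{2}(horner_mx_X A) -rmorphXn -rmorphM /= -mulrA.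
by rewrite rmorphM /= CH mulr0.
Qed.

(** * Polynomial interpolation *)

Section Interpolation.
Variable K : fieldType.
Implicit Types (p q r : {poly K}) (s : seq K) (v : K -> K).

Lemma coprimep_prod_XsubC_exp s m a :
  a \notin s -> coprimep (\prod_(b <- s) ('X - b%:P) ^+ m) (('X - a%:P) ^+ m).
Proof.
move=> s'a; apply: coprimep_expr; rewrite coprimep_XsubC rootE horner_prod.
rewrite prodf_seq_neq0; apply/allP=> b sb /=.
rewrite hornerE hornerXsubC expf_neq0 // subr_eq0.
by apply: contraNneq s'a => ->.
Qed.

Lemma poly_interpolation s v m :
    uniq s ->
  exists r, {in s, forall a, ('X - a%:P) ^+ m %| r - (v a)%:P}.
Proof.
elim: s => [|a s IHs] /=; first by exists 0.
case/andP=> s'a /IHs[r rP].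
set P := \prod_(b <- s) ('X - b%:P) ^+ m.
have /Bezout_eq1_coprimepP[[u w] /= uw1] := coprimep_prod_XsubC_exp m s'a.
(* The correction is divisible by [P], so nothing changes at the points of [s]; modulo the power at
   [a], [u * P] is 1 and the sum becomes [v a]. *)
exists (r + ((v a)%:P - r) * u * P) => b; rewrite inE => /predU1P[-> | sb].
  have -> : r + ((v a)%:P - r) * u * P - (v a)%:P =
            (r - (v a)%:P) * w * ('X - a%:P) ^+ m.
    rewrite -[RHS]mulrA; have -> : w * ('X - a%:P) ^+ m = 1 - u * P.
      by apply/eqP; rewrite eq_sym subr_eq addrC uw1.
    by ring.
  exact: dvdp_mulIr.
rewrite addrAC dvdp_add ?rP // dvdp_mull //.
by rewrite /P (big_rem b) //= dvdp_mulIl.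
Qed.

Lemma dvdp_prod_XsubC_exp s m q :
    uniq s -> {in s, forall a, ('X - a%:P) ^+ m %| q} ->
  \prod_(a <- s) ('X - a%:P) ^+ m %| q.
Proof.
elim: s => [|a s IHs] /=; first by rewrite big_nil dvd1p.
case/andP=> s'a Us sq; rewrite big_cons Gauss_dvdp.
  by rewrite sq ?mem_head // IHs // => b sb; rewrite sq // inE sb orbT.
by rewrite coprimep_sym coprimep_prod_XsubC_exp.
Qed.

(** No root is repeated more than [size s] times. This turns a split characteristic polynomial into
    an annihilator with distinct roots and a uniform exponent. *)
Lemma dvdp_prod_undup s :
  \prod_(a <- s) ('X - a%:P) %| \prod_(a <- undup s) ('X - a%:P) ^+ size s.
Proof.
rewrite prodrXl; set P := \prod_(a <- undup s) _.
have sP a : a \in s -> 'X - a%:P %| P.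
  by move=> sa; rewrite /P (big_rem a) ?mem_undup //= dvdp_mulIl.
move: P sP; elim: s => [|a s IHs] P sP; first by rewrite big_nil dvd1p.
rewrite big_cons exprS dvdp_mul ?sP ?mem_head // IHs // => b sb.
by rewrite sP // inE sb orbT.
Qed.

End Interpolation.

(** * Polynomials in a linear operator *)

Section PolyAct.
Variables (K : fieldType) (V : lmodType K) (D : {linear V -> V}).
Implicit Types (r q : {poly K}) (w : V).

Definition poly_act r w : V := \sum_(i < size r) r`_i *: iter i D w.

Lemma poly_act_widen n r w :
  (size r <= n)%N -> poly_act r w = \sum_(i < n) r`_i *: iter i D w.
Proof.
move=> le_r_n.
rewrite /poly_act (big_ord_widen n (fun i => r`_i *: iter i D w)) //.
rewrite big_mkcond; apply: eq_bigr => i _; case: ltnP => // le_r_i.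
by rewrite nth_default ?scale0r.
Qed.

Lemma poly_actDl r q w : poly_act (r + q) w = poly_act r w + poly_act q w.
Proof.
pose n := maxn (size r) (size q).
rewrite !(@poly_act_widen n) ?leq_maxl ?leq_maxr ?size_polyD //.
by rewrite -big_split; apply: eq_bigr => i _; rewrite coefD scalerDl.
Qed.

Lemma poly_actZl a r w : poly_act (a *: r) w = a *: poly_act r w.
Proof.
rewrite (poly_act_widen _ (size_scale_leq a r)) /poly_act scaler_sumr.
by apply: eq_bigr => i _; rewrite coefZ scalerA.
Qed.

Lemma poly_actC a w : poly_act a%:P w = a *: w.
Proof. by rewrite (poly_act_widen w (size_polyC_leq1 a)) big_ord1 coefC. Qed.

Lemma poly_actMX r w : poly_act (r * 'X) w = poly_act r (D w).
Proof.
have le_rX : (size (r * 'X)%R <= (size r).+1)%N.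
  have [-> | r0] := eqVneq r 0; first by rewrite mul0r size_poly0.
  by rewrite size_mulX.
rewrite (poly_act_widen w le_rX) big_ord_recl coefMX scale0r add0r.
by apply: eq_bigr => i _; rewrite coefMX /= -iterSr.
Qed.

Lemma poly_actDr r w1 w2 : poly_act r (w1 + w2) = poly_act r w1 + poly_act r w2.
Proof.
rewrite /poly_act -big_split; apply: eq_bigr => i _ /=.
rewrite -scalerDr; congr (_ *: _); elim: (val i) => //= n ->.
by rewrite linearD.
Qed.

Lemma poly_act0r r : poly_act r 0 = 0.
Proof.
by apply: (addIr (poly_act r 0)); rewrite -poly_actDr !add0r.
Qed.

Lemma poly_actZr r a w : poly_act r (a *: w) = a *: poly_act r w.
Proof.
rewrite /poly_act scaler_sumr; apply: eq_bigr => i _.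
rewrite scalerA mulrC -scalerA; congr (_ *: _); elim: (val i) => //= n ->.
by rewrite linearZ.
Qed.

Lemma poly_act_sumr (I : Type) (s : seq I) (F : I -> V) r :
  poly_act r (\sum_(i <- s) F i) = \sum_(i <- s) poly_act r (F i).
Proof.
exact: (big_morph (poly_act r) (poly_actDr r) (poly_act0r r)).
Qed.

(** On a generalized eigenvector for [d], only the residue of [r] modulo a power of ['X - d%:P]
    matters. *)
Lemma poly_act_eigen r a d m w :
    ('X - d%:P) ^+ m %| r - a%:P -> iter m (fun u => D u - d *: u) w = 0 ->
  poly_act r w = a *: w.
Proof.
case/dvdpP=> q Dr Dm0; rewrite -[r](subrK a%:P) poly_actDl poly_actC Dr.
suff -> : poly_act (q * ('X - d%:P) ^+ m) w = 0 by rewrite add0r.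
elim: m w Dm0 {Dr} => [|m IHm] w Dm0.
  by move: Dm0 => /= ->; rewrite poly_act0r.
rewrite exprSr mulrA mulrBr poly_actDl poly_actMX [_ * d%:P]mulrC mul_polyC.
rewrite -scaleNr poly_actZl -poly_actZr -poly_actDr scaleNr.
by apply: IHm; rewrite -iterSr.
Qed.

End PolyAct.

(** * Splitting fields and integral relations *)

Lemma splitting_extension (F : fieldType) (p : {poly F}) :
    p != 0 ->
  exists (K : fieldExtType F) (zs : seq K),
    map_poly (in_alg K) p %= \prod_(z <- zs) ('X - z%:P).
Proof.
have [n] := ubnP (size p); elim: n => // n IHn in F p * => lbn nz_p.
have [Cp | C'p] := leqP (size p) 1.
  exists F^o, [::].
  by rewrite big_nil -size_poly_eq1 size_map_poly eqn_leq Cp size_poly_gt0.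
have [r r_dv_p irr_r] : exists2 r, r %| p & irreducible_poly r.
  (* A nonconstant divisor of least size is irreducible. *)
  pose P m :=
    `[< exists r : {poly F}, [/\ (1 < size r)%N, r %| p & size r = m] >].
  have exP : exists m, P m by exists (size p); apply/asboolP; exists p.
  case: (ex_minnP exP) => m /asboolP[r [C'r r_dv_p sz_r]] minm.
  exists r => //; split=> // q C'q q_dv_r.
  have nz_r : r != 0 by rewrite -size_poly_gt0 ltnW.
  have nz_q : q != 0 by apply: dvdpN0 nz_r.
  rewrite -dvdp_size_eqp // eqn_leq dvdp_leq //= sz_r minm //.
  apply/asboolP; exists q; split=> //; last exact: dvdp_trans r_dv_p.
  by rewrite ltn_neqAle eq_sym C'q size_poly_gt0.
have [K _ [x rx0 _]] := irredp_FAdjoin irr_r.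
have /factor_theorem[q Dp] : root (map_poly (in_alg K) p) x.
  by rewrite -(divpK r_dv_p) rmorphM rootM rx0 orbT.
have Dszp : size p = size (q * ('X - x%:P)) by rewrite -Dp size_map_poly.
have nz_q : q != 0.
  by move: nz_p; rewrite -size_poly_eq0 Dszp size_poly_eq0 mulf_eq0 => /norP[].
have [|L [zs Dq]] := IHn K q _ nz_q.
  by rewrite Dszp size_mul ?polyXsubC_eq0 ?size_XsubC ?addn2 in lbn.
suffices: exists ys : seq L, map_poly (in_alg L) (map_poly (in_alg K) p)
    %= \prod_(z <- ys) ('X - z%:P).
  rewrite -map_poly_comp -(eq_map_poly (fun a : F => baseField_scaleE a 1)).
  by exists (baseFieldType L).
exists (x%:A :: zs); rewrite big_cons Dp mulrC rmorphM /= rmorphB /=.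
by rewrite map_polyX map_polyC eqp_mull.
Qed.

Section Arithmetic.
Variables (K : fieldType) (char0 : [pchar K] =i pred0).

Lemma intr_eq0_char0 (z : int) : (z%:~R == 0 :> K) = (z == 0).
Proof.
move/pcharf0P: char0 => nat0.
by case: z => n; rewrite ?NegzE ?mulrNz ?oppr_eq0 [LHS]nat0.
Qed.

(** Clearing denominators leaves an identity between integers, and these embed in any field of
    characteristic zero. *)
Lemma ratr_char0P (x : rat) (m n : int) :
  m%:~R * x = n%:~R -> m%:~R * ratr x = n%:~R :> K.
Proof.
have dn0 : (denq x)%:~R != 0 :> rat by rewrite intr_eq0 denq_neq0.
have dK0 : (denq x)%:~R != 0 :> K by rewrite intr_eq0_char0 denq_neq0.
rewrite -{1}[x]divq_num_den mulrA => /(canRL (divfK dn0)).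
rewrite -!intrM => /intr_inj mn.
by rewrite /ratr mulrA; apply: (canLR (mulfK dK0)); rewrite -!intrM mn.
Qed.

Lemma ratr_denq (x : rat) : (denq x)%:~R * ratr x = (numq x)%:~R :> K.
Proof. by apply: ratr_char0P; rewrite mulrC -numqE. Qed.

Lemma ratr_linear_char0 (a x y : rat) :
  ratr (a * x + y) = ratr a * ratr x + ratr y :> K.
Proof.
pose d := denq a * denq x * denq y.
have d0 : d%:~R != 0 :> K by rewrite intr_eq0_char0 !mulf_neq0 ?denq_neq0.
apply: (mulfI d0).
transitivity ((numq a * numq x * denq y + denq a * denq x * numq y)%:~R : K).
  apply: ratr_char0P; rewrite /d !(intrM, intrD).
  by rewrite !numqE; ring.
rewrite /d !(intrM, intrD) -!ratr_denq; ring.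
Qed.

Lemma common_denominator (s : seq K) (g : K -> rat) :
  exists (N : int) (F : K -> int),
    N != 0 /\ {in s, forall a, N%:~R * g a = (F a)%:~R}.
Proof.
pose N := \prod_(a <- s) denq (g a).
exists N, (fun a => numq (N%:~R * g a)); split.
  by rewrite /N prodf_seq_neq0; apply/allP=> a _; rewrite denq_neq0.
move=> a sa; rewrite /N (big_rem a) //= intrM mulrAC [_%:~R * g a]mulrC -numqE.
by rewrite -intrM numq_int.
Qed.

(* Were a nonzero [a] with [w a != 0] in [s], a rational functional vanishing *)
(* on the relations between the elements of [s], but not at the coordinate of *)
(* [a], would give an [F] such that [\sum (F b * w b) b = 0]; applying the    *)
(* functional to this very relation yields [\sum w b (F b)^2 = 0].            *)
Lemma int_functionals_separate (s : seq K) (w : K -> nat) :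
    uniq s ->
    (forall F : K -> int,
       (forall z : K -> int, \sum_(a <- s) (z a)%:~R * a = 0 ->
          \sum_(a <- s) z a * F a = 0) ->
       \sum_(a <- s) (F a * (w a)%:Z)%:~R * a = 0) ->
  {in s, forall a, w a != 0%N -> a = 0}.
Proof.
move=> Us Hw a sa wa; apply/eqP/negPn/negP=> a0.
pose r := size s; pose S (q : 'rV[rat]_r) := \sum_j ratr (q 0 j) * s`_j.
have Slin c u v : S (c *: u + v) = ratr c * S u + S v :> K.
  rewrite /S mulr_sumr -big_split; apply: eq_bigr => j _ /=.
  by rewrite !mxE ratr_linear_char0 mulrDl mulrA.
have S0 : S 0 = 0.
  by apply: big1 => j _; rewrite mxE /ratr mul0r mul0r.
have [||U UP] := @vspace_comprehension _ 'rV[rat]_r (fun q => S q = 0).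
- exact: S0.
- by move=> c u v; rewrite Slin => -> ->; rewrite mulr0 addr0.
pose e b : 'rV[rat]_r := \row_j (s`_j == b)%:R.
have Se b : b \in s -> S (e b) = b.
  move=> sb; have lt_b : (index b s < r)%N by rewrite index_mem.
  rewrite /S (bigD1 (Ordinal lt_b)) //= big1 ?addr0.
    by rewrite mxE nth_index // eqxx (ratr_nat _ 1) mul1r.
  move=> j ne_j; rewrite mxE.
  rewrite [_ == b]negbTE ?(ratr_nat _ 0) ?mul0r //.
  by apply: contraNneq ne_j => sjb; rewrite -val_eqE /= -sjb index_uniq.
have Ssum (z : K -> rat) t : {subset t <= s} ->
    S (\sum_(b <- t) z b *: e b) = \sum_(b <- t) ratr (z b) * b.
  elim: t => [|b t IHt] ts; first by rewrite !big_nil.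
  rewrite !big_cons Slin IHt ?Se ?ts ?mem_head // => c tc.
  by rewrite ts // inE tc orbT.
(* Since [a] is nonzero, [e a] is not in the space [U] of rational relations; [phi] below is a
   coordinate of the component off [U], so it kills [U] but not [e a]. *)
have [j phi_a] : exists j, (e a - projv U (e a)) 0 j != 0.
  apply/existsP; rewrite -[X in is_true X]negbK; apply/negP=> /existsPn phi0.
  have /UP : e a \in U.
    have -> : e a = projv U (e a).
      apply/eqP; rewrite -subr_eq0; apply/eqP/rowP=> j.
      by rewrite [RHS]mxE; apply/eqP/negPn.
    exact: memv_proj.
  by rewrite Se // => /eqP; apply/negP.
pose phi q := (q - projv U q) 0 j.
have phiD u v : phi (u + v) = phi u + phi v.
  by rewrite /phi linearD !mxE; ring.
have phiZ c u : phi (c *: u) = c * phi u.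
  by rewrite /phi linearZ !mxE mulrBr.
have phi0 : phi 0 = 0 by rewrite -(scale0r 0) phiZ mul0r.
have phiU q : q \in U -> phi q = 0.
  by move=> Uq; rewrite /phi projv_id // subrr mxE.
have [N [F [N0 FP]]] := common_denominator s (phi \o e).
have Forth (z : K -> int) : \sum_(b <- s) (z b)%:~R * b = 0 ->
    \sum_(b <- s) z b * F b = 0.
  move=> zs0; apply: (@intr_inj rat); rewrite rmorph_sum /=.
  have : phi (\sum_(b <- s) (z b)%:~R *: e b) = 0.
    apply/phiU/UP; rewrite Ssum // -[RHS]zs0.
    by apply: eq_bigr => b _; rewrite ratr_int.
  rewrite (big_morph phi phiD phi0) => zphi.
  transitivity (N%:~R * \sum_(b <- s) phi ((z b)%:~R *: e b)).
    rewrite mulr_sumr; apply: eq_big_seq => b sb.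
    by rewrite phiZ intrM -FP //=; ring.
  by rewrite zphi mulr0.
have := Forth _ (Hw F Forth); apply/eqP.
rewrite (eq_bigr (fun b => (w b)%:Z * F b ^+ 2)); last by move=> b _; ring.
rewrite psumr_neq0; last by move=> b _; rewrite mulr_ge0 // sqr_ge0.
apply/hasP; exists a => //=; rewrite lt_def mulr_ge0 ?sqr_ge0 // andbT.
rewrite mulf_neq0 // expf_neq0 // -(intr_eq0 rat) -FP //= mulf_neq0 //.
by rewrite intr_eq0.
Qed.

End Arithmetic.

(** * Spectral idempotents *)

Definition commx (K : fieldType) n (A : 'M[K]_n) : 'M[K]_n -> 'M[K]_n :=
  mulmx A \- mulmxr A.

HB.instance Definition _ (K : fieldType) n (A : 'M[K]_n) :=
  GRing.Linear.copy (commx A) (mulmx A \- mulmxr A).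

Lemma commxE (K : fieldType) n (A B : 'M[K]_n) : commx A B = A *m B - B *m A.
Proof. by []. Qed.

Lemma subBB (V : zmodType) (a b c d : V) : a - b - (c - d) = a - c - (b - d).
Proof. by rewrite !opprD !opprK addrACA. Qed.

Section Spectral.
Variables (K : fieldType) (n : nat) (A : 'M[K]_n.+1) (s : seq K) (m : nat).
Hypotheses (Us : uniq s).
Hypothesis annA : horner_mx A (\prod_(a <- s) ('X - a%:P) ^+ m) = 0.

Lemma horner_mx_congr p q :
    {in s, forall a, ('X - a%:P) ^+ m %| p - q} ->
  horner_mx A p = horner_mx A q.
Proof.
move=> /(dvdp_prod_XsubC_exp Us)/dvdpP[t Dpq].
by apply/eqP; rewrite -subr_eq0 -rmorphB Dpq rmorphM /= annA mulr0.
Qed.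

(** By interpolation there is a polynomial that is 1 modulo the power at [a] and 0 modulo the
    others; its value at [A] is the projection [E a] on the generalized eigenspace. *)
Lemma spectral_idempotents :
  exists E : K -> 'M[K]_n.+1,
    [/\ \sum_(a <- s) E a = 1,
        {in s, forall a, (A - a%:M) ^+ m * E a = 0},
        {in s, forall a, GRing.comm A (E a)} &
        {in s &, forall a b, E a * E b = if a == b then E a else 0}].
Proof.
have /choice[e eP] : forall a, exists r, {in s, forall b,
    ('X - b%:P) ^+ m %| r - ((b == a)%:R)%:P}.
  by move=> a; apply: (poly_interpolation (fun b => (b == a)%:R)).
exists (fun a => horner_mx A (e a)); split=> [|a sa|a sa|a b sa sb].
- rewrite -rmorph_sum -(rmorph1 (horner_mx A)) /=.
  apply: horner_mx_congr => c sc.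
  have -> : 1 = \sum_(a <- s) ((c == a)%:R)%:P :> {poly K}.
    rewrite (big_rem c) //= eqxx big_seq big1 ?addr0 // => a.
    rewrite mem_rem_uniq // inE => /andP[ne_ac _].
    by rewrite eq_sym (negbTE ne_ac).
  rewrite -sumrB; elim/big_rec: _ => [|a q _ dvq]; first exact: dvdp0.
  by rewrite dvdp_add ?eP.
- rewrite -(rmorph0 (horner_mx A)).
  have -> : A - a%:M = horner_mx A ('X - a%:P).
    by rewrite rmorphB /= horner_mx_X horner_mx_C.
  rewrite -rmorphXn -rmorphM /=; apply: horner_mx_congr => c sc; rewrite subr0.
  have [-> | ne_ca] := eqVneq c a; first exact: dvdp_mulIl.
  by rewrite dvdp_mull //; have := eP a c sc; rewrite (negbTE ne_ca) subr0.
- by apply: comm_mx_horner.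
- rewrite -rmorphM /= -[RHS](_ : horner_mx A (if a == b then e a else 0) = _).
    apply: horner_mx_congr => c sc.
    have [u Du] := dvdpP _ _ (eP a c sc); have [w Dw] := dvdpP _ _ (eP b c sc).
    have ea : e a = u * ('X - c%:P) ^+ m + ((c == a)%:R)%:P.
      by rewrite -Du subrK.
    have eb : e b = w * ('X - c%:P) ^+ m + ((c == b)%:R)%:P.
      by rewrite -Dw subrK.
    have [ab | ne_ab] := eqVneq a b.
      subst b; have -> : e a * e a - e a =
          (e a - (c == a)%:R%:P) * (e a + (c == a)%:R%:P - 1).
        by case: (c == a); rewrite ?polyC1 ?polyC0; ring.
      by rewrite Du dvdp_mulr // dvdp_mulIr.
    rewrite subr0; have [ca | ne_ca] := eqVneq c a.
      rewrite eb -ca in ne_ab *; rewrite (negbTE ne_ab) addr0 mulrA.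
      exact: dvdp_mulIr.
    by rewrite ea (negbTE ne_ca) addr0 mulrAC dvdp_mulIr.
  by case: eqP => // _; rewrite rmorph0.
Qed.

(** Left and right multiplications commute, so each term of the binomial expansion has at least [i]
    factors [N1] or at least [j] factors [N2]. *)
Lemma iter_mul_sub_nilpotent (N1 N2 w : 'M[K]_n.+1) i j :
    N1 ^+ i * w = 0 -> w * N2 ^+ j = 0 ->
  iter (i + j) (fun u => N1 * u - u * N2) w = 0.
Proof.
pose D u := N1 * u - u * N2.
have D0 k : iter k D 0 = 0 by elim: k => //= k ->; rewrite /D mulr0 mul0r subr0.
have DB k u v : iter k D (u - v) = iter k D u - iter k D v.
  by elim: k => //= k ->; rewrite /D mulrBr mulrBl subBB.
have [k] := ubnP (i + j)%N; elim: k => // k IHk in i j w *.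
case: i => [|i] lt_k N1w wN2; first by rewrite -(mul1r w) N1w D0.
case: j => [|j] in lt_k wN2 *; first by rewrite -(mulr1 w) wN2 D0.
rewrite addSn iterSr -/D DB; rewrite ltnS in lt_k.
rewrite IHk //; last 2 first.
- by rewrite mulrA -exprSr.
- by rewrite -mulrA wN2 mulr0.
rewrite addnS -addSn IHk ?subr0 //.
- by move: lt_k; rewrite addnS addSn.
- by rewrite mulrA N1w mul0r.
- by rewrite -mulrA -exprS.
Qed.

(* The sum is the replica of [A] with eigenvalue [v a] on the generalized     *)
(* eigenspace of [a]. On each [E a *m B *m E b] the commutators with it and   *)
(* with [A] have generalized eigenvalues [v a - v b] and [a - b].             *)
Lemma commx_poly_act (E : K -> 'M[K]_n.+1) (v : K -> K) :
    \sum_(a <- s) E a = 1 ->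
    {in s, forall a, (A - a%:M) ^+ m * E a = 0} ->
    {in s, forall a, GRing.comm A (E a)} ->
    {in s &, forall a b, E a * E b = if a == b then E a else 0} ->
    (forall a b c d, a \in s -> b \in s -> c \in s -> d \in s ->
       a - b = c - d -> v a - v b = v c - v d) ->
  exists r, forall B,
    commx (\sum_(a <- s) v a *: E a) B = poly_act (commx A) r B.
Proof.
move=> E1 Enil Ecomm Eid vP; set y := \sum_(a <- s) _.
have yE a : a \in s -> y * E a = v a *: E a.
  move=> sa; rewrite /y (big_rem a) //= mulrDl mulr_suml big_seq big1 ?addr0.
    by rewrite -scalerAl Eid // eqxx.
  move=> b; rewrite mem_rem_uniq // inE => /andP[ne_ba sb].
  by rewrite -scalerAl Eid // (negbTE ne_ba) scaler0.
have Ey a : a \in s -> E a * y = v a *: E a.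
  move=> sa; rewrite /y (big_rem a) //= mulrDr mulr_sumr big_seq big1 ?addr0.
    by rewrite -scalerAr Eid // eqxx.
  move=> b; rewrite mem_rem_uniq // inE => /andP[ne_ba sb].
  by rewrite -scalerAr Eid // eq_sym (negbTE ne_ba) scaler0.
pose S := [seq (a, b) | a <- s, b <- s].
(* Any pair with difference [d] serves, by the hypothesis on [v]; the default [(0, 0)] is never
   reached for differences of elements of [s]. *)
pose g d := let u := nth (0, 0) S (find (fun u => u.1 - u.2 == d) S) in
  v u.1 - v u.2.
have gP a b : a \in s -> b \in s -> g (a - b) = v a - v b.
  move=> sa sb; have hasS : has (fun u => u.1 - u.2 == a - b) S.
    by apply/hasP; exists (a, b) => //; apply/allpairsP; exists (a, b).
  rewrite /g; have /eqP := nth_find (0, 0) hasS.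
  have: nth (0, 0) S (find (fun u => u.1 - u.2 == a - b) S) \in S.
    by rewrite mem_nth // -has_find.
  by case/allpairsP=> -[c d] /= [sc sd ->]; apply: vP.
have [r rP] :=
  poly_interpolation g (m + m) (undup_uniq [seq u.1 - u.2 | u <- S]).
exists r => B.
have dec w : w = \sum_(a <- s) \sum_(b <- s) E a * w * E b.
  rewrite -{1}[w]mulr1 -E1 mulr_sumr exchange_big; apply: eq_bigr => b _ /=.
  by rewrite -{1}[w]mul1r -E1 !mulr_suml.
rewrite (dec B) poly_act_sumr linear_sum; apply: eq_big_seq => a sa.
rewrite poly_act_sumr linear_sum; apply: eq_big_seq => b sb.
transitivity ((v a - v b) *: (E a * B * E b)).
  rewrite /= commxE -[y *m _]/(y * (E a * B * E b)).
  rewrite -[_ *m y]/(E a * B * E b * y) 2!mulrA yE //.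
  by rewrite -[in X in _ - X]mulrA Ey // -!scalerAl -scalerAr scalerBl.
rewrite -gP //; apply/esym/(poly_act_eigen (d := a - b) (m := m + m)).
  apply: rP; rewrite mem_undup; apply/mapP; exists (a, b) => //.
  by apply/allpairsP; exists (a, b).
rewrite (eq_iter (f' := fun u => (A - a%:M) * u - u * (A - b%:M))).
  apply: iter_mul_sub_nilpotent; first by rewrite 2!mulrA Enil // !mul0r.
  rewrite -mulrA.
  have -> : E b * (A - b%:M) ^+ m = (A - b%:M) ^+ m * E b.
    apply: commrX; apply: commrB; first exact/commr_sym/Ecomm.
    exact: comm_mx_scalar.
  by rewrite Enil // mulr0.
move=> u; rewrite /= commxE mulrBl mulrBr.
rewrite -[a%:M * u]/(a%:M *m u) -[u * b%:M]/(u *m b%:M).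
by rewrite mul_scalar_mx mul_mx_scalar scalerBl subBB.
Qed.

End Spectral.

(** [(A - a%:M) * E] is nilpotent, hence of trace zero, and the trace of [E] is its rank. *)
Lemma mxtrace_mul_idempotent (K : fieldType) n (A E : 'M[K]_n.+1) a m :
    GRing.comm A E -> E * E = E -> (A - a%:M) ^+ m * E = 0 ->
  \tr (A * E) = a * (\rank E)%:R.
Proof.
move=> cAE EE AaE.
have cE : GRing.comm (A - a%:M) E.
  apply/commr_sym/commrB; first exact/commr_sym.
  exact: comm_mx_scalar.
have N0 : \tr ((A - a%:M) * E) = 0.
  apply: (@mxtrace_nilpotent _ _ _ m.+1); rewrite exprMn_comm //.
  by rewrite exprS (exprS E) -mulrA [_ ^+ m * _]mulrA AaE mul0r mulr0.
rewrite -(mxtrace_idempotent EE) -mxtraceZ -mul_scalar_mx.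
by apply/eqP; rewrite -subr_eq0 -linearB /= -mulmxBl; apply/eqP.
Qed.

(* Over a splitting field [K], take a replica of [c] with integral            *)
(* eigenvalues [F a]. Its coordinates over [k] normalize [G], so the          *)
(* hypothesis makes the trace of its product with [c], which is the sum of    *)
(* the [F a * \rank (E a) * a], vanish for all admissible [F].                *)
Lemma nilpotent_of_normalizer_orthogonal (k : fieldType) n
    (c : 'M[k]_n) (G : {vspace 'M[k]_n}) :
    [pchar k] =i pred0 -> {in G, forall b, commx c b \in G} ->
    (forall z, {in G, forall b, commx z b \in G} -> \tr (c *m z) = 0) ->
  exists m, c ^+ m = 0.
Proof.
case: n c G => [|n] c G char0 Gc Gz; first by exists 1%N; apply: thinmx0.
have [K [zs]] := splitting_extension (monic_neq0 (char_poly_monic c)).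
rewrite eqp_monic ?map_monic ?char_poly_monic ?monic_prod_XsubC //.
move=> /eqP Dzs.
pose A := map_mx (in_alg K) c; pose s := undup zs; pose m := size zs.
have charK : [pchar K] =i pred0 by move=> p; rewrite pchar_lalg char0.
have annA : horner_mx A (\prod_(a <- s) ('X - a%:P) ^+ m) = 0.
  have /dvdpP[q ->] := dvdp_prod_undup zs.
  by rewrite -Dzs map_char_poly rmorphM /= Cayley_Hamilton mulr0.
have Us : uniq s := undup_uniq zs.
have [E [E1 Enil Ecomm Eid]] := spectral_idempotents Us annA.
have trAE a : a \in s -> \tr (A * E a) = a * (\rank (E a))%:R.
  move=> sa; apply: mxtrace_mul_idempotent (Enil a sa); first exact: Ecomm.
  by rewrite Eid // eqxx.
have eig0 : {in s, forall a, \rank (E a) != 0%N -> a = 0}.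
  apply: int_functionals_separate => // F HF.
  pose v a : K := (F a)%:~R.
  have vP a b e d : a \in s -> b \in s -> e \in s -> d \in s ->
      a - b = e - d -> v a - v b = v e - v d.
    move=> sa sb se sd abed.
    pose i x y : int := (x == y :> K)%:R.
    have isum (V : zmodType) (f : K -> V) x : x \in s ->
        \sum_(y <- s) f y *~ i x y = f x.
      move=> sx; rewrite (big_rem x) //= /i eqxx mulr1z big_seq big1 ?addr0 //.
      move=> y; rewrite mem_rem_uniq // inE => /andP[ne_yx _].
      by rewrite eq_sym (negbTE ne_yx) mulr0z.
    (* The equality of differences, written as an integral relation on [s]. Summing indicators
       allows coincidences among [a], [b], [e], [d]. *)
    pose z x := i a x - i b x - (i e x - i d x).
    have zsum (V : zmodType) (f : K -> V) :
        \sum_(x <- s) f x *~ z x = f a - f b - (f e - f d).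
      rewrite -(isum _ f _ sa) -(isum _ f _ sb).
      rewrite -(isum _ f _ se) -(isum _ f _ sd) -!sumrB.
      by apply: eq_bigr => x _; rewrite /z !mulrzBr.
    have := HF z; under eq_bigr do rewrite mulrzl.
    rewrite (zsum K id) abed subrr => /(_ erefl).
    under eq_bigr do rewrite mulrC -mulrzz.
    rewrite zsum => Fz; apply/eqP; rewrite -subr_eq0 /v -!intrB.
    by rewrite Fz.
  have [r rP] := commx_poly_act Us E1 Enil Ecomm Eid vP.
  set y := \sum_(a <- s) _ in rP.
  suff trAy : \tr (A * y) = 0.
    rewrite -[RHS]trAy /y mulr_sumr linear_sum; apply: eq_big_seq => a sa.
    by rewrite -scalerAr linearZ /= trAE // intrM -mulrzr; ring.
  pose X := vbasis {:K}.
  have map_coordM l (B : 'M[K]_n.+1) (b : 'M[k]_n.+1) :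
      map_mx (coord X l) (B * map_mx (in_alg K) b) = map_mx (coord X l) B * b.
    apply/matrixP=> i j; rewrite !mxE linear_sum; apply: eq_bigr => h _.
    by rewrite !mxE mulr_algr linearZ mulrC.
  have map_coordMl l (B : 'M[K]_n.+1) (b : 'M[k]_n.+1) :
      map_mx (coord X l) (map_mx (in_alg K) b * B) = b * map_mx (coord X l) B.
    apply/matrixP=> i j; rewrite !mxE linear_sum; apply: eq_bigr => h _.
    by rewrite !mxE mulr_algl linearZ.
  have coord_tr l (B : 'M[K]_n.+1) :
      coord X l (\tr B) = \tr (map_mx (coord X l) B).
    by rewrite linear_sum; apply: eq_bigr => i _; rewrite mxE.
  rewrite [LHS](coord_vbasis (memvf _)) big1 // => l _.
  rewrite -/X coord_tr map_coordMl Gz ?scale0r // => b Gb.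
  have -> : commx (map_mx (coord X l) y) b =
            map_mx (coord X l) (commx y (map_mx (in_alg K) b)).
    by rewrite !commxE map_mxB map_coordM map_coordMl.
  (* Taking coordinates over [k] turns [poly_act] into a [k]-combination of iterates of [commx c] on
     [b], all of which lie in [G]. *)
  rewrite rP /poly_act raddf_sum memv_suml // => i _ /=.
  have -> : iter i (commx A) (map_mx (in_alg K) b) =
            map_mx (in_alg K) (iter i (commx c) b).
    by elim: (val i) => //= j ->; rewrite !commxE map_mxB !map_mxM.
  set B := iter _ _ _.
  have -> : map_mx (coord X l) (r`_i *: map_mx (in_alg K) B) =
            coord X l r`_i *: B.
    by apply/matrixP=> h j; rewrite !mxE mulr_algr linearZ mulrC.
  rewrite memvZ // /B; elim: (val i) => //= j IHj; exact: Gc.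
(* Split [A ^+ m] along the idempotents: either [E a] is zero, or [a] is zero and [A ^+ m] kills
   [E a]. *)
exists m; apply/eqP; rewrite -(map_mx_eq0 (in_alg K)); apply/eqP.
rewrite rmorphXn /= -/A -[LHS]mulr1 -E1 mulr_sumr big_seq big1 // => a sa.
have [/eqP | Ea0] := eqVneq (\rank (E a)) 0%N.
  by rewrite mxrank_eq0 => /eqP->; rewrite mulr0.
by have := Enil a sa; rewrite (eig0 a sa Ea0) raddf0 subr0.
Qed.

(** * Common kernels of nilpotent actions *)

Lemma ex_min_vspace (K : fieldType) (V : vectType K) (P : {vspace V} -> Prop) :
    (exists U, P U) ->
  exists U, P U /\ forall W, P W -> (\dim U <= \dim W)%N.
Proof.
move=> [U0 PU0]; pose Q n := `[< exists U, P U /\ \dim U = n >].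
have exQ : exists n, Q n by exists (\dim U0); apply/asboolP; exists U0.
case: (ex_minnP exQ) => n /asboolP[U [PU <-]] minU.
by exists U; split=> // W PW; apply: minU; apply/asboolP; exists W.
Qed.

Lemma ex_max_vspace (K : fieldType) (V : vectType K) (P : {vspace V} -> Prop) :
    (exists U, P U) ->
  exists U, P U /\ forall W, P W -> (\dim W <= \dim U)%N.
Proof.
move=> [U0 PU0]; pose Q n := `[< exists U, P U /\ \dim U = n >].
have exQ : exists n, Q n by exists (\dim U0); apply/asboolP; exists U0.
have ubQ n : Q n -> (n <= \dim {:V})%N.
  by move=> /asboolP[U [_ <-]]; rewrite dimvS ?subvf.
case: (ex_maxnP exQ ubQ) => n /asboolP[U [PU <-]] maxU.
by exists U; split=> // W PW; apply: maxU; apply/asboolP; exists W.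
Qed.

Section LieAlgebras.
Variables (k : fieldType) (L : lieAlgType k).
Implicit Types (x y z v : L) (U W A I J H : {vspace L}).

Lemma lie0l x : lie 0 x = 0 :> L. Proof. exact: (raddf0 (lier x)). Qed.
Lemma lie0r x : lie x 0 = 0 :> L. Proof. exact: raddf0. Qed.

(** The Jacobi identity, read as a right action of [L] on itself, to match row vectors multiplied by
    matrices. *)
Lemma lieA v x y : lie v (lie x y) = lie (lie v x) y - lie (lie v y) x.
Proof.
have /eqP := lie_jacobi v x y; rewrite -addrA addr_eq0 => /eqP ->.
rewrite (lie_antisym x) (lie_antisym y (lie v x)) opprD !opprK.
rewrite (lie_antisym y v) -[lie (- _) x]/(lier x _) raddfN /=.
by rewrite addrC.
Qed.

Lemma lieAC v x y : lie (lie v x) y = lie (lie v y) x + lie v (lie x y).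
Proof. by rewrite lieA addrC subrK. Qed.

Lemma is_ideal_r I x y : is_ideal I -> x \in I -> lie x y \in I.
Proof. by move=> idI Ix; rewrite lie_antisym memvN idI. Qed.

Lemma liev_ind (P : L -> Prop) U W :
    P 0 -> (forall a x y, P x -> P y -> P (a *: x + y)) ->
    {in U & W, forall x y, P (lie x y)} ->
  {in liev U W, forall x, P x}.
Proof.
move=> P0 Plin PUW; have [V VP] := vspace_comprehension P0 Plin.
have /subvP sV : (liev U W <= V)%VS.
  by apply/lievP=> x y Ux Wy; apply/VP/PUW.
by move=> x /sV/VP.
Qed.

Lemma solvable_lieS U W : (U <= W)%VS -> solvable_lie W -> solvable_lie U.
Proof.
move=> sUW [n W0]; exists n; apply/eqP; rewrite -subv0 -W0.
exact: derived_seriesS.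
Qed.

Lemma solvable_lie_ext U W :
  (liev U U <= W)%VS -> solvable_lie W -> solvable_lie U.
Proof.
move=> sUW /(solvable_lieS sUW)[n U0]; exists n.+1.
by rewrite /derived_series iterSr.
Qed.

Lemma derived_series_ideal n U :
  is_subalgebra U -> {in derived_series n U & U, forall x y,
    lie x y \in derived_series n U}.
Proof.
move=> algU; elim: n => [|n IHn] x y; first exact: algU.
move=> Dx Uy; move: x Dx; apply: liev_ind.
- by rewrite lie0l mem0v.
- by move=> a x1 x2 Dx1 Dx2; rewrite lieDl lieZl memvD ?memvZ.
- by move=> a b Da Db; rewrite lieAC memvD ?memv_lie ?IHn.
Qed.

Definition normalizes x U := forall v, v \in U -> lie v x \in U.

Lemma normalizes_lie x y A :
  normalizes x A -> normalizes y A -> normalizes (lie x y) A.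
Proof. by move=> xA yA v Av; rewrite lieA memvB ?xA ?yA ?xA. Qed.

(* Mod [U], the elements of [A] act on [W] as commuting nilpotent maps. *)
Lemma common_kernel U W A :
    (U <= W)%VS -> ~~ (W <= U)%VS ->
    {in A, forall x, normalizes x U} -> {in A, forall x, normalizes x W} ->
    {in A & A, forall x y v, v \in W -> lie v (lie x y) \in U} ->
    {in A, forall x, exists m, forall v, v \in W -> iter m (lier x) v \in U} ->
  exists v, [/\ v \in W, v \notin U & {in A, forall x, lie v x \in U}].
Proof.
move=> sUW nWU AU AW Acomm Anil.
pose P W' := [/\ (U <= W')%VS, (W' <= W)%VS, ~~ (W' <= U)%VS &
  {in A, forall x, normalizes x W'}].
have [|W' [[sUW' sW'W nW'U AW'] minW']] := @ex_min_vspace _ _ P.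
  by exists W; split.
have /subvPn[v W'v Uv] := nW'U.
exists v; split=> // [|x Ax]; first exact: (subvP sW'W).
(* The image of [W'] under [x], enlarged by [U], is stable under [A] by commutativity. By minimality
   it is inside [U], as wanted, or equal to [W']; then [x] is onto modulo [U], against
   nilpotency. *)
pose W'' := (linfun (lier x) @: W' + U)%VS.
have W''P w : w \in W'' <->
    exists w' u, [/\ w' \in W', u \in U & w = lie w' x + u].
  split=> [/memv_addP[_ /memv_imgP[w' W'w' ->] [u Uu ->]] |].
    by exists w', u; rewrite lfunE.
  move=> [w' [u [W'w' Uu ->]]].
  by rewrite memv_add // -[lie w' x]/(lier x w') -lfunE memv_img.
have sW''W' : (W'' <= W')%VS.
  apply/subvP=> _ /W''P[w' [u [W'w' Uu ->]]].
  by rewrite memvD ?(subvP sUW' _ Uu) // AW'.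
have [sW''U | nW''U] := boolP (W'' <= U)%VS.
  by apply/(subvP sW''U)/W''P; exists v, 0; rewrite mem0v addr0.
have eqW : W'' = W'.
  apply/eqP; rewrite eqEdim sW''W' minW' //; split=> //.
  - exact: addvSr.
  - exact: subv_trans sW'W.
  move=> t At _ /W''P[w' [u [W'w' Uu ->]]]; apply/W''P.
  exists (lie w' t), (lie w' (lie x t) + lie u t); split.
  - exact: AW'.
  - by apply: memvD; [apply: Acomm => //; apply: (subvP sW'W) | apply: AU].
  - by rewrite lieDl lieAC addrA.
have [m nilx] := Anil x Ax; case/negP: nW'U; apply/subvP=> w W'w.
suff [w' [W'w' Uww']] : exists w', w' \in W' /\ w - iter m (lier x) w' \in U.
  by rewrite -(subrK (iter m (lier x) w') w) memvD // nilx // (subvP sW'W).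
elim: m {nilx} => [|m [w1 [W'w1 Uw1]]]; first by exists w; rewrite subrr mem0v.
have /W''P[w' [u [W'w' Uu Dw1]]] : w1 \in W'' by rewrite eqW.
exists w'; split=> //; rewrite iterSr.
have -> : w - iter m (lier x) (lier x w') =
    w - iter m (lier x) w1 + iter m (lier x) u.
  rewrite Dw1 -addrA; congr (w + _).
  have -> a b : iter m (lier x) (a + b) = iter m (lier x) a + iter m (lier x) b.
    by elim: m {w1 W'w1 Uw1 Dw1} => //= m ->; rewrite linearD.
  by rewrite opprD subrK.
by rewrite memvD //; elim: m {w1 W'w1 Uw1 Dw1} => //= m; apply: AU.
Qed.

(** An Engel-type statement, by going up the derived series from its zero term: once a term's
    derived algebra acts trivially on a section, the term acts by commuting maps, and its common
    kernel is stable under [H] because the term is an ideal of [H]. *)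
Lemma solvable_common_kernel U W H :
    is_subalgebra H -> solvable_lie H -> (U <= W)%VS -> ~~ (W <= U)%VS ->
    {in H, forall x, normalizes x U} -> {in H, forall x, normalizes x W} ->
    {in H, forall x, exists m, forall v, v \in W -> iter m (lier x) v \in U} ->
  exists v, [/\ v \in W, v \notin U & {in H, forall x, lie v x \in U}].
Proof.
move=> algH [n Hn] sUW nWU HU HW Hnil.
pose Q i W' := [/\ (U <= W')%VS, (W' <= W)%VS, ~~ (W' <= U)%VS,
  {in H, forall x, normalizes x W'} &
  forall x v, x \in derived_series i H -> v \in W' -> lie v x \in U].
suff [W' [_ sW'W /subvPn[v W'v Uv] _ W'0]] : exists W', Q 0 W'.
  by exists v; split=> // [|x Hx]; [apply: (subvP sW'W) | apply: W'0].
have : exists W', Q n W'.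
  exists W; split=> // x v; rewrite Hn memv0 => /eqP-> _.
  by rewrite lie0r mem0v.
elim: {Hn} n => // i IHi [W1 [sUW1 sW1W nW1U HW1 W1i]]; apply: IHi.
have sDH x : x \in derived_series i H -> x \in H.
  apply/subvP: x; elim: i {W1i} => //= j IHj; apply/lievP => a b.
  by move=> /(subvP IHj) Ha /(subvP IHj); apply: algH.
have [//|//|||||v [W1v Uv vD]] := @common_kernel U W1 (derived_series i H).
- by move=> x /sDH; apply: HU.
- by move=> x /sDH; apply: HW1.
- by move=> x y Dx Dy v; apply: W1i; apply: memv_lie.
- move=> x /sDH/Hnil[m nilx]; exists m => u /(subvP sW1W); exact: nilx.
have [||W2 W2P] := @vspace_comprehension _ _ (fun v => v \in W1 /\
   {in derived_series i H, forall x, lie v x \in U}).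
- by split=> [|x _]; rewrite ?lie0l mem0v.
- move=> a u w [W1u uD] [W1w wD].
  by split=> [|x Dx]; rewrite ?lieDl ?lieZl memvD ?memvZ ?uD ?wD.
exists W2; split.
- apply/subvP=> u Uu; apply/W2P; split; first exact: (subvP sUW1).
  by move=> x /sDH Hx; apply: HU.
- by apply: subv_trans sW1W; apply/subvP=> u /W2P[].
- by apply/subvPn; exists v => //; apply/W2P.
- move=> x Hx u /W2P[W1u uD]; apply/W2P; split; first exact: HW1.
  move=> t Dt; rewrite lieAC memvD //; first exact/HU/uD.
  by apply: uD; rewrite lie_antisym memvN derived_series_ideal.
- by move=> x u Dx /W2P[_]; apply.
Qed.

(* A maximal proper subalgebra containing [I] is solvable by induction, and   *)
(* its common kernel on the quotient normalizes it, as in Engel's theorem.    *)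
Lemma solvable_of_nilpotent_action I H :
    is_ideal I -> solvable_lie I -> is_subalgebra H -> (I <= H)%VS ->
    {in H, forall x, exists m, forall v, iter m (lier x) v \in I} ->
  solvable_lie H.
Proof.
move=> idI solI; have [n] := ubnP (\dim H); elim: n => // n IHn in H *.
move=> lt_H algH sIH Hnil.
have [/solvable_lieS|nHI] := boolP (H <= I)%VS; first exact.
pose P A := [/\ is_subalgebra A, (I <= A)%VS, (A <= H)%VS & ~~ (H <= A)%VS].
have [|A [[algA sIA sAH nHA] maxA]] := @ex_max_vspace _ _ P.
  by exists I; split=> // x y Ix _; apply: is_ideal_r.
have solA : solvable_lie A.
  apply: IHn => // [|x /(subvP sAH)]; last exact: Hnil.
  rewrite -ltnS; apply: leq_trans lt_H; rewrite ltnS ltnNge.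
  apply: contra nHA => leHA; rewrite -(_ : A = H) //.
  by apply/eqP; rewrite eqEdim sAH.
have [|||z [Hz Az zA]] := @solvable_common_kernel A H A algA solA sAH nHA.
- by move=> x Ax v Av; apply: algA.
- by move=> x /(subvP sAH) Hx v Hv; apply: algH.
- move=> x /(subvP sAH)/Hnil[m nilx]; exists m => v _.
  exact: (subvP sIA).
(* [z] normalizes [A], so [B] is a subalgebra with derived algebra in [A]; maximality of [A] then
   leaves no room for [H] beyond [B]. *)
pose B := (A + <[z]>)%VS.
have BB : (liev B B <= A)%VS.
  apply/lievP=> u w /memv_addP[a Aa [_ /vlineP[c ->] ->]].
  move=> /memv_addP[b Ab [_ /vlineP[d ->] ->]].
  rewrite lieDl !lieDr !lieZl !lieZr liexx !scaler0 addr0.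
  rewrite (memvD (memvD _ _)) ?memvZ ?(zA b) ?(algA a b) //.
  by rewrite lie_antisym memvN zA.
suff sHB : (H <= B)%VS.
  by apply: solvable_lie_ext solA; apply: subv_trans BB; apply: lievS.
apply/negPn/negP=> nHB.
have/maxA : P B.
  split=> //.
  - move=> x y Bx By; apply: (subvP (addvSl _ _)); apply: (subvP BB).
    exact: memv_lie.
  - exact: subv_trans sIA (addvSl _ _).
  - by rewrite subv_add sAH -memvE.
apply/negP; rewrite -ltnNge ltn_neqAle dimvS ?addvSl // andbT.
apply: contra Az => /eqP dimAB.
have -> : A = B by apply/eqP; rewrite eqEdim addvSl dimAB /=.
by rewrite (subvP (addvSr _ _)) ?memv_line.
Qed.

End LieAlgebras.

(** * Linear representations on sections *)

Section Sections.
Variables (k : fieldType) (L : lieAlgType k).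
Implicit Types (x y z v : L) (U W A I J H : {vspace L}).

(* [pi] identifies [W / U] with ['rV_n], and [phi x] is the matrix of the map *)
(* induced by [lie^~ x] when [x] normalizes both [U] and [W].                 *)
Definition is_section_rep U W n (pi : L -> 'rV[k]_n) (phi : L -> 'M[k]_n) :=
  [/\ linear pi,
      forall v, v \in W -> (pi v = 0 <-> v \in U),
      forall u, exists v, v \in W /\ pi v = u &
      forall x v, normalizes x U -> normalizes x W -> v \in W ->
        pi (lie v x) = pi v *m phi x].

(** [pi] takes coordinates on the complement [W :\: U] after projecting along [U]. *)
Lemma ex_section_rep U W :
  (U <= W)%VS -> exists n pi phi, @is_section_rep U W n pi phi.
Proof.
move=> sUW; pose C := (W :\: U)%VS; pose X := vbasis C.
pose p := addv_pi1 W U.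
have pC v : p v \in C by apply: memv_pi.
have pW v : v \in W -> p v + addv_pi2 W U v = v.
  by move=> Wv; rewrite addv_pi1_pi2 // (subvP (addvSl _ _)).
have p0 v : v \in U -> p v = 0.
  move=> Uv; apply: (addIr (addv_pi2 W U v)).
  by rewrite pW ?(subvP sUW) // add0r addv_pi2_id.
have XC i : X`_i \in C.
  have [lt_i | ge_i] := ltnP i (size X); first by rewrite vbasis_mem ?mem_nth.
  by rewrite nth_default ?mem0v.
have CW v : v \in C -> v \in W by apply/subvP/diffvSl.
pose pi v : 'rV[k]_(\dim C) := \row_i coord X i (p v).
have pi_lin : linear pi.
  by move=> a u v; apply/rowP=> i; rewrite !mxE !linearP.
have pi_sum (u : 'I_(\dim C) -> k) (F : 'I_(\dim C) -> L) :
    pi (\sum_i u i *: F i) = \sum_i u i *: pi (F i).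
  apply/rowP=> i; rewrite !mxE summxE !linear_sum; apply: eq_bigr => j _.
  by rewrite !mxE !linearZ.
exists (\dim C), pi, (fun x => \matrix_i pi (lie X`_i x)); split=> //.
- move=> v Wv; split=> [pi0 | Uv]; last first.
    by apply/rowP=> i; rewrite !mxE p0 ?linear0.
  rewrite -(pW v Wv) (coord_vbasis (pC v)) big1 ?add0r ?memv_pi2 // => i _.
  by have /rowP/(_ i) := pi0; rewrite !mxE => ->; rewrite scale0r.
- move=> u; pose v := \sum_i u 0 i *: X`_i.
  have Cv : v \in C by apply: memv_suml => i _; rewrite memvZ.
  have pv : p v = v by rewrite /p /addv_pi1 daddv_pi_id ?capv_diff.
  exists v; split; first exact: CW.
  apply/rowP=> i; rewrite mxE pv coord_sum_free //.
  exact: basis_free (vbasisP C).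
- move=> x v xU xW Wv.
  have -> : pi (lie v x) = pi (lie (p v) x).
    have := pi_lin 1 (lie (p v) x) (lie (addv_pi2 W U v) x).
    rewrite !scale1r -lieDl pW // => ->.
    have -> : pi (lie (addv_pi2 W U v) x) = 0; last by rewrite addr0.
    by apply/rowP=> i; rewrite !mxE p0 ?linear0 // xU // memv_pi2.
  rewrite {1}(coord_vbasis (pC v)) lie_suml.
  under eq_bigr do rewrite lieZl.
  rewrite pi_sum; apply/rowP=> i; rewrite summxE !mxE; apply: eq_bigr => j _.
  by rewrite !mxE.
Qed.

Section Rep.
Variables (U W : {vspace L}) (n : nat).
Variables (pi : L -> 'rV[k]_n) (phi : L -> 'M[k]_n).
Hypothesis rep : is_section_rep U W pi phi.

Lemma section_rep_eq (M N : 'M[k]_n) :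
  (forall v, v \in W -> pi v *m M = pi v *m N) -> M = N.
Proof.
case: rep => _ _ pi_surj _ eqMN; apply/row_matrixP=> i; rewrite !rowE.
by have [v [Wv <-]] := pi_surj (delta_mx 0 i); apply: eqMN.
Qed.

Lemma section_rep_projB u v : pi (u - v) = pi u - pi v.
Proof.
by case: rep => pi_lin _ _ _; rewrite addrC -scaleN1r pi_lin scaleN1r addrC.
Qed.

Lemma section_rep_lie x y :
    normalizes x U -> normalizes x W -> normalizes y U -> normalizes y W ->
  phi (lie x y) = phi x *m phi y - phi y *m phi x.
Proof.
case: rep => _ _ _ act xU xW yU yW; apply: section_rep_eq => v Wv.
rewrite -act //; try exact: normalizes_lie.
rewrite lieA section_rep_projB !act ?xW ?yW //.
by rewrite mulmxBr !mulmxA.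
Qed.

Lemma section_rep_lin a x y :
    normalizes x U -> normalizes x W -> normalizes y U -> normalizes y W ->
  phi (a *: x + y) = a *: phi x + phi y.
Proof.
case: rep => pi_lin _ _ act xU xW yU yW; apply: section_rep_eq => v Wv.
have axyA A : normalizes x A -> normalizes y A -> normalizes (a *: x + y) A.
  by move=> xA yA u Au; rewrite lieDr lieZr memvD ?memvZ ?xA ?yA.
rewrite -act //; try exact: axyA.
by rewrite lieDr lieZr pi_lin !act // mulmxDr scalemxAr.
Qed.

Lemma section_rep_eq0 x : normalizes x U -> normalizes x W ->
  (phi x = 0 <-> forall v, v \in W -> lie v x \in U).
Proof.
case: rep => _ pi0 _ act xU xW; split=> [phi0 v Wv | xWU].
  by apply/(pi0 _ (xW v Wv)); rewrite act // phi0 mulmx0.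
apply: section_rep_eq => v Wv; rewrite mulmx0 -act //.
by apply/pi0; [apply: xW | apply: xWU].
Qed.

Lemma section_rep_nilpotent x m : normalizes x U -> normalizes x W ->
  (phi x ^+ m = 0 <-> forall v, v \in W -> iter m (lier x) v \in U).
Proof.
case: rep => _ pi0 _ act xU xW.
have Wit v : v \in W -> iter m (lier x) v \in W.
  by move=> Wv; elim: m => //= j; apply: xW.
have itE v : v \in W -> pi (iter m (lier x) v) = pi v *m phi x ^+ m.
  have: v \in W -> iter m (lier x) v \in W /\
      pi (iter m (lier x) v) = pi v *m phi x ^+ m.
    move=> Wv; elim: m {Wit} => [|j [Wj IHj]]; first by rewrite /= expr0 mulmx1.
    by rewrite /= xW // act // IHj -mulmxA exprSr.
  by move=> itP /itP[].
split=> [phi0 v Wv | xWU].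
  by apply/(pi0 _ (Wit v Wv)); rewrite itE // phi0 mulmx0.
apply: section_rep_eq => v Wv; rewrite mulmx0 -itE //.
by apply/pi0; [apply: Wit | apply: xWU].
Qed.

(* If [c] is a sum of brackets [lie x y] such that [phi c] commutes with the  *)
(* [phi y], then so does [phi c ^+ i], and [\tr (phi c ^+ i.+1) = 0].         *)
Lemma section_rep_nilpotent_lie A J c :
    [pchar k] =i pred0 ->
    {in A, forall x, normalizes x U /\ normalizes x W} ->
    {in J, forall x, normalizes x U /\ normalizes x W} ->
    {in J, forall y, phi c *m phi y = phi y *m phi c} -> c \in liev A J ->
  exists m, phi c ^+ m = 0.
Proof.
move=> char0 AN JN cJ Ac; apply: mx_nilpotent_trace => // i.
pose P d := [/\ normalizes d U, normalizes d W & \tr (phi c ^+ i *m phi d) = 0].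
suff : {in liev A J, forall d, P d} by case/(_ c Ac) => _ _; rewrite exprSr.
apply: liev_ind.
- have zN B : normalizes 0 B by move=> v _; rewrite lie0r mem0v.
  split; rewrite // (_ : phi 0 = 0) ?mulmx0 ?raddf0 //.
  by apply/section_rep_eq0 => // v _; rewrite lie0r mem0v.
- move=> a x y [xU xW tx] [yU yW ty]; split.
  + by move=> v Uv; rewrite lieDr lieZr memvD ?memvZ ?xU ?yU.
  + by move=> v Wv; rewrite lieDr lieZr memvD ?memvZ ?xW ?yW.
  rewrite section_rep_lin // mulmxDr -scalemxAr linearD linearZ /=.
  by rewrite tx ty mulr0 addr0.
move=> x y /AN[xU xW] Jy; have [yU yW] := JN y Jy.
split; try exact: normalizes_lie.
(* As [phi y] commutes with [phi c ^+ i], cyclicity of the trace cancels the two halves of the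
   bracket. *)
have cy : phi y *m phi c ^+ i = phi c ^+ i *m phi y.
  exact/commrX/esym/cJ.
rewrite section_rep_lie // mulmxBr linearB /=; apply/eqP; rewrite subr_eq0.
by rewrite mulmxA mxtrace_mulC mulmxA cy mulmxA.
Qed.

End Rep.
End Sections.

(** * The derived algebra of a solvable algebra acts nilpotently *)

Section DerivedNilpotent.
Variables (k : fieldType) (L : lieAlgType k).
Implicit Types (x y z v : L) (U W A I J H : {vspace L}).

(* The vectors of [W] that [I] maps into [U] are stable under [H].            *)
Lemma minimal_section_kernel H I U W :
    (U <= W)%VS -> ~~ (W <= U)%VS ->
    {in H, forall x, normalizes x U} -> {in H, forall x, normalizes x W} ->
    (forall W', (U <= W')%VS -> (W' <= W)%VS -> ~~ (W' <= U)%VS ->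
       {in H, forall x, normalizes x W'} -> (\dim W <= \dim W')%N) ->
    (I <= H)%VS -> {in I & H, forall b x, lie b x \in I} ->
    {in I & I, forall b c v, v \in W -> lie v (lie b c) \in U} ->
    {in I, forall c, exists m, forall v, v \in W -> iter m (lier c) v \in U} ->
  {in I, forall c v, v \in W -> lie v c \in U}.
Proof.
move=> sUW nWU HU HW minW /subvP sIH idI Icomm Inil.
have [//|//|||//|//|v [Wv Uv vI]] := @common_kernel _ _ U W I.
- by move=> x /sIH; apply: HU.
- by move=> x /sIH; apply: HW.
have [||W0 W0P] := @vspace_comprehension _ _ (fun v => v \in W /\
   {in I, forall x, lie v x \in U}).
- by split=> [|x _]; rewrite ?lie0l mem0v.
- move=> a u w [Wu uI] [Ww wI].
  by split=> [|x Ix]; rewrite ?lieDl ?lieZl memvD ?memvZ ?uI ?wI.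
have sW0W : (W0 <= W)%VS by apply/subvP=> u /W0P[].
have -> : W = W0; last by move=> c Ic u /W0P[_]; apply.
apply/esym/eqP; rewrite eqEdim sW0W minW //.
- apply/subvP=> u Uu; apply/W0P; split; first exact: (subvP sUW).
  by move=> x /sIH Hx; apply: HU.
- by apply/subvPn; exists v => //; apply/W0P.
- move=> x Hx u /W0P[Wu uI]; apply/W0P; split; first exact: HW.
  move=> t It; rewrite lieAC memvD //; first exact/HU/uI.
  by apply: uI; rewrite lie_antisym memvN idI.
Qed.

(* Descending induction on the derived series of [H]: for a term [A] whose    *)
(* derived algebra acts trivially on [W / U], first [[H, A]], which commutes  *)
(* with [A], and then [A], which commutes with [H], act by matrices all of    *)
(* whose powers have trace zero.                                              *)
Lemma solvable_minimal_section H U W :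
    [pchar k] =i pred0 -> is_subalgebra H -> solvable_lie H ->
    (U <= W)%VS -> ~~ (W <= U)%VS ->
    {in H, forall x, normalizes x U} -> {in H, forall x, normalizes x W} ->
    (forall W', (U <= W')%VS -> (W' <= W)%VS -> ~~ (W' <= U)%VS ->
       {in H, forall x, normalizes x W'} -> (\dim W <= \dim W')%N) ->
  {in liev H H, forall c v, v \in W -> lie v c \in U}.
Proof.
move=> char0 algH [N HN] sUW nWU HU HW minW.
have [n [pi [phi rep]]] := ex_section_rep sUW.
have HN' x : x \in H -> normalizes x U /\ normalizes x W.
  by move=> Hx; split; [apply: HU | apply: HW].
pose D i := derived_series i H.
have idD i : {in D i & H, forall x y, lie x y \in D i}.
  exact: derived_series_ideal.
have sDH i : (D i <= H)%VS.
  elim: i => // i IHi; apply/lievP=> a b /(subvP IHi) Ha /(subvP IHi).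
  exact: algH.
have commE x y : x \in H -> y \in H ->
    (forall v, v \in W -> lie v (lie x y) \in U) ->
    phi x *m phi y = phi y *m phi x.
  move=> Hx Hy xy0; apply/eqP; rewrite -subr_eq0; apply/eqP.
  have [[xU xW] [yU yW]] := (HN' x Hx, HN' y Hy).
  rewrite -(section_rep_lie rep) //.
  by apply/(section_rep_eq0 rep) => //; apply: normalizes_lie.
have nilE c : c \in H -> (exists m, phi c ^+ m = 0) ->
    exists m, forall v, v \in W -> iter m (lier c) v \in U.
  move=> /HN'[cU cW] [m /(section_rep_nilpotent rep m cU cW)].
  by exists m.
suff WD j i : (i + j)%N = N ->
    {in D i.+1, forall c v, v \in W -> lie v c \in U}.
  exact: (WD N 0%N).
elim: j i => [|j IHj] i.
  rewrite addn0 => -> c; rewrite /D /= [derived_series N H]HN => Dc v _.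
  suff /eqP-> : c == 0 by rewrite lie0r mem0v.
  move: c Dc; apply: liev_ind => // [a x y /eqP-> /eqP->|x y].
    by rewrite scaler0 addr0.
  by rewrite memv0 => /eqP-> _; rewrite lie0l.
rewrite addnS -addSn => /IHj Wi2; set A := D i.+1 in Wi2 *.
have Acomm : {in A & A, forall b c v, v \in W -> lie v (lie b c) \in U}.
  by move=> b c Ab Ac v; apply: Wi2; apply: memv_lie.
have sAH := subvP (sDH i.+1); have idA := idD i.+1.
pose I := liev H A.
have sIA : {subset I <= A}.
  apply/subvP/lievP=> x b Hx Ab.
  by rewrite lie_antisym memvN idA.
have idI : {in I & H, forall b x, lie b x \in I}.
  move=> b x Ib Hx; move: b Ib; apply: liev_ind.
  - by rewrite lie0l mem0v.
  - by move=> a b c Ib Ic; rewrite lieDl lieZl memvD ?memvZ.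
  - move=> y b Hy Ab; rewrite lieAC.
    by apply: memvD; apply: memv_lie => //; [exact: algH | exact: idA].
have WI : {in I, forall c v, v \in W -> lie v c \in U}.
  apply: (minimal_section_kernel sUW nWU HU HW) => // [|b c /sIA Ab /sIA|c Ic].
  - by apply/subvP=> x /sIA/sAH.
  - exact: Acomm.
  apply: nilE; first exact/sAH/sIA.
  apply: (section_rep_nilpotent_lie rep char0 HN' _ _ Ic).
    by move=> x /sAH/HN'.
  move=> y Ay.
  apply: commE => [||v]; [exact/sAH/sIA | exact: sAH |].
  by apply: Acomm => //; apply: sIA.
apply: (minimal_section_kernel sUW nWU HU HW) => // [|c Ac]; first exact: sDH.
apply: nilE; first exact: sAH.
have DN x : x \in D i -> normalizes x U /\ normalizes x W.
  by move=> /(subvP (sDH i)); apply: HN'.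
apply: (section_rep_nilpotent_lie rep char0 DN DN _ Ac) => y.
move=> /(subvP (sDH i)) Hy.
apply/esym/commE => [//||v]; first exact: sAH.
by apply: WI; apply: memv_lie.
Qed.

(** Take a largest [H]-stable [U] on which the derived algebra acts nilpotently. On a minimal stable
    [W] above it, [W / U] is killed by the derived algebra, so [W] would also qualify. *)
Lemma solvable_derived_nilpotent H :
    [pchar k] =i pred0 -> is_subalgebra H -> solvable_lie H ->
  {in liev H H, forall c, exists m, forall v, iter m (lier c) v = 0}.
Proof.
move=> char0 algH solH.
pose P U := {in H, forall x, normalizes x U} /\
  {in liev H H, forall c, exists m, forall v, v \in U -> iter m (lier c) v = 0}.
have [|U [[HU Unil] maxU]] := @ex_max_vspace _ _ P.
  exists 0%VS; split=> [x _ v|c _].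
    by rewrite memv0 => /eqP->; rewrite lie0l mem0v.
  by exists 0 => v; rewrite memv0 => /eqP.
have [fU | nU] := boolP (fullv <= U)%VS.
  by move=> c /Unil[m Um]; exists m => v; apply: Um; rewrite (subvP fU) ?memvf.
pose Q W := [/\ (U <= W)%VS, ~~ (W <= U)%VS & {in H, forall x, normalizes x W}].
have [|W [[sUW nWU HW] minW]] := @ex_min_vspace _ _ Q.
  by exists fullv; split=> [||x _ v _]; rewrite ?subvf ?memvf.
have WU : {in liev H H, forall c v, v \in W -> lie v c \in U}.
  apply: (solvable_minimal_section char0 algH solH sUW nWU HU HW).
  by move=> W' sUW' _ nW'U HW'; apply: minW.
case/negP: nWU; suff <- : U = W by [].
apply/eqP; rewrite eqEdim sUW maxU //; split=> // c Hc.
have [m Um] := Unil c Hc; exists m.+1 => v Wv; rewrite iterSr.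
by apply: Um; apply: WU.
Qed.

End DerivedNilpotent.

(** * The radical and its trace form *)

Section Radical.
Variables (k : fieldType) (L : lieAlgType k).
Implicit Types (x y z v : L) (U W I J H : {vspace L}).

Local Notation R := (solvable_radical L).

Lemma ideal_add_line I x : is_ideal I -> (forall v, lie v x \in I) ->
  forall u w, w \in (I + <[x]>)%VS -> lie u w \in I.
Proof.
move=> idI xI u w /memv_addP[a Ia [_ /vlineP[c ->] ->]].
by rewrite lieDr lieZr memvD //; [apply: idI | apply/memvZ/xI].
Qed.

(** [L / R] has no centre: a central line added to [R] gives an ideal whose derived algebra is in
    [R]. *)
Lemma mem_solvable_radical x : (forall v, lie v x \in R) -> x \in R.
Proof.
have [[idR solR] maxR] := solvable_radicalP L.
move=> xR; have JR := ideal_add_line idR xR.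
apply: (subvP (maxR (R + <[x]>)%VS _)); last first.
  by rewrite (subvP (addvSr _ _)) ?memv_line.
split; first by move=> u w /(JR u); apply/subvP/addvSl.
apply: solvable_lie_ext solR; apply/lievP=> u w _; exact: JR.
Qed.

Section RadicalRep.
Variables (n : nat) (pi : L -> 'rV[k]_n) (phi : L -> 'M[k]_n).
Hypothesis rep : is_section_rep R fullv pi phi.

Lemma normalizes_radical x : normalizes x R.
Proof.
by have [[idR _] _] := solvable_radicalP L; move=> v; apply: is_ideal_r.
Qed.

Lemma normalizes_fullv x : normalizes x fullv.
Proof. by move=> v _; apply: memvf. Qed.

#[local] Hint Resolve normalizes_radical normalizes_fullv : core.

Lemma radical_rep_lie x y : phi (lie x y) = phi x *m phi y - phi y *m phi x.
Proof. exact: section_rep_lie rep _ _ _ _ _ _. Qed.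

Lemma radical_rep_lin a x y : phi (a *: x + y) = a *: phi x + phi y.
Proof. exact: section_rep_lin rep _ _ _ _ _ _ _. Qed.

Lemma radical_rep0 x : x \in R -> phi x = 0.
Proof.
have [[idR _] _] := solvable_radicalP L.
by move=> Rx; apply/(section_rep_eq0 rep) => // v _; apply: idR.
Qed.

(* The kernel [J] is an ideal, and [[L, J]] acts nilpotently on [L / R] since *)
(* its matrices are orthogonal to the normalizer of the image of [phi].       *)
Lemma trace_form_kernel_sub_radical : [pchar k] =i pred0 ->
  forall x, (forall z, \tr (phi x *m phi z) = 0) -> x \in R.
Proof.
have [[idR solR] maxR] := solvable_radicalP L.
move=> char0; have phi00 : phi 0 = 0 by rewrite radical_rep0 ?mem0v.
have [||J JP] := @vspace_comprehension _ _
   (fun x => forall z, \tr (phi x *m phi z) = 0).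
- by move=> z; rewrite phi00 mul0mx raddf0.
- move=> a u v u0 v0 z.
  rewrite radical_rep_lin mulmxDl -scalemxAl linearD linearZ /=.
  by rewrite u0 v0 mulr0 addr0.
suff sDR : (liev fullv J <= R)%VS.
  move=> x /JP Jx; apply: mem_solvable_radical => v.
  by apply: (subvP sDR); rewrite memv_lie ?memvf.
have idJ a j : j \in J -> lie a j \in J.
  move=> /JP Jj; apply/JP => z; have := Jj (lie z a).
  rewrite !radical_rep_lie mulmxBr mulmxBl !linearB /= !mulmxA => <-.
  by congr (_ - _); rewrite [RHS]mxtrace_mulC mulmxA.
have idD : is_ideal (liev fullv J).
  move=> a d; move: d; apply: liev_ind.
  - by rewrite lie0r mem0v.
  - by move=> c u v Du Dv; rewrite lieDr lieZr memvD ?memvZ.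
  - by move=> u j _ Jj; rewrite memv_lie ?memvf ?idJ.
have [||G GP] := @vspace_comprehension _ _
   (fun B : 'M[k]_n => exists x, B = phi x).
- by exists 0.
- by move=> a _ _ [u ->] [v ->]; exists (a *: u + v); rewrite radical_rep_lin.
have Dnil c : c \in liev fullv J -> exists m, phi c ^+ m = 0.
  move=> Dc; apply: (nilpotent_of_normalizer_orthogonal (G := G) char0).
    by move=> _ /GP[x ->]; apply/GP; exists (lie c x); rewrite radical_rep_lie.
  move=> Z GZ; move: c Dc; apply: liev_ind.
  - by rewrite phi00 mul0mx raddf0.
  - move=> a u v u0 v0.
    rewrite radical_rep_lin mulmxDl -scalemxAl linearD linearZ /=.
    by rewrite u0 v0 mulr0 addr0.
  (* Invariance of the trace moves the bracket with [phi a] from [phi j] onto [Z]; the result is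
     some [phi b], to which [phi j] is orthogonal. *)
  move=> a j _ /JP Jj; have /GP[b Zb] : commx Z (phi a) \in G.
    by apply: GZ; apply/GP; exists a.
  have := Jj b; rewrite -Zb commxE radical_rep_lie mulmxBr mulmxBl !linearB /=.
  rewrite !mulmxA => <-.
  by congr (_ - _); rewrite [RHS]mxtrace_mulC mulmxA.
suff : (liev fullv J + R <= R)%VS by apply: subv_trans (addvSl _ _).
have idDR : is_ideal (liev fullv J + R)%VS.
  move=> x _ /memv_addP[d Dd [r Rr ->]].
  by rewrite lieDr memv_add ?idD ?idR.
apply: maxR; split=> //.
apply: (solvable_of_nilpotent_action idR solR) => [x y _|  |x].
- exact: idDR.
- exact: addvSr.
move=> /memv_addP[d Dd [r Rr ->]]; have [m dm] := Dnil d Dd.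
have phi_dr : phi (d + r) = phi d.
  by rewrite -[d]scale1r radical_rep_lin !scale1r (radical_rep0 Rr) addr0.
have [nil_iter _] := section_rep_nilpotent rep m
  (@normalizes_radical (d + r)) (@normalizes_fullv (d + r)).
by exists m => v; apply: nil_iter (memvf v); rewrite phi_dr.
Qed.

End RadicalRep.
End Radical.

Theorem theorem2p1 (k : fieldType) (char0 : [pchar k]%R =i pred0)
    (L : lieAlgType k) (y : L) :
  y \in solvable_radical L <->
  forall x : L, solvable_lie (generated_subalgebra [:: x; y]).
Proof.
have [[idR solR] maxR] := solvable_radicalP L; split=> [Ry x | soly].
  have [algG _ minG] := generated_subalgebraP [:: x; y].
  pose B := (solvable_radical L + <[x]>)%VS.
  have BB : (liev B B <= solvable_radical L)%VS.
    apply/lievP=> u w /memv_addP[a Ra [_ /vlineP[c ->] ->]].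
    move=> /memv_addP[b Rb [_ /vlineP[d ->] ->]].
    rewrite lieDr lieZr [lie _ x]lieDl lieZl liexx scaler0 addr0.
    by apply: memvD; [apply: idR | apply/memvZ/is_ideal_r].
  apply: (@solvable_lieS _ _ _ B); last exact: solvable_lie_ext solR.
  apply: minG.
    move=> u w Bu Bw; apply: (subvP (addvSl _ _)); apply: (subvP BB).
    exact: memv_lie.
  move=> u; rewrite !inE => /orP[] /eqP->.
    by rewrite (subvP (addvSr _ _)) ?memv_line.
  by rewrite (subvP (addvSl _ _)).
have two0 : 2%:R != 0 :> k by move/pcharf0P: char0 => ->.
have [n [pi [phi rep]]] := ex_section_rep (subvf (solvable_radical L)).
have kerR := trace_form_kernel_sub_radical rep char0.
have phi_lie := radical_rep_lie rep.
have phiD u v : phi (u + v) = phi u + phi v.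
  by rewrite -[u]scale1r (radical_rep_lin rep) !scale1r.
have sq0 x : \tr (phi (lie x y) *m phi (lie x y)) = 0.
  have [algG sG _] := generated_subalgebraP [:: x; y].
  have [|m xym] :=
    solvable_derived_nilpotent char0 algG (soly x) (x := lie x y).
    by rewrite memv_lie ?sG // !inE eqxx ?orbT.
  apply: (@mxtrace_nilpotent _ _ _ m).
  have [_ nil_phi] := section_rep_nilpotent rep m
    (@normalizes_radical _ L (lie x y)) (@normalizes_fullv _ L (lie x y)).
  rewrite exprMn_comm // nil_phi ?mul0r // => v _.
  by rewrite xym mem0v.
have polar x z : \tr (phi (lie x y) *m phi (lie z y)) = 0.
  have := sq0 (x + z).
  rewrite lieDl phiD mulmxDl !mulmxDr !linearD /= !sq0 add0r addr0.
  rewrite [\tr (phi (lie z y) *m _)]mxtrace_mulC -mulr2n -mulr_natl => /eqP.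
  by rewrite mulf_eq0 (negbTE two0) => /eqP.
have yyR z : lie y (lie z y) \in solvable_radical L.
  apply: kerR => x; rewrite -[RHS](polar x z) phi_lie [phi (lie x y)]phi_lie.
  set w := phi (lie z y); rewrite !mulmxBl !linearB /=; congr (_ - _).
    by rewrite mxtrace_mulC mulmxA.
  by rewrite [RHS]mxtrace_mulC mulmxA.
have YY : phi y *m phi y = 0.
  have [pi_lin pi0 _ act] := rep.
  apply: (section_rep_eq rep) => v _; rewrite mulmx0 mulmxA.
  have yR := @normalizes_radical _ L y; have yL := @normalizes_fullv _ L y.
  (* On [L / R], applying [phi y] twice to the class of [v] gives the class of [[[v, y], y] = - [y,
     [v, y]]], which is zero by [yyR]. *)
  rewrite -!act ?memvf //; apply/pi0; rewrite ?memvf //.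
  by rewrite lie_antisym memvN yyR.
have YXY x : phi y *m phi x *m phi y = 0.
  have := radical_rep0 rep (yyR x); rewrite !phi_lie mulmxBr mulmxBl.
  rewrite [phi y *m (phi y *m _)]mulmxA YY mul0mx subr0.
  rewrite -[phi x *m _ *m _]mulmxA YY mulmx0 add0r opprK mulmxA.
  rewrite -mulr2n -scaler_nat => /eqP.
  by rewrite scaler_eq0 (negbTE two0) => /eqP.
apply: kerR => x; apply: (@mxtrace_nilpotent _ _ _ 2).
by rewrite expr2 -[_ * _]/(_ *m _) mulmxA YXY mul0mx.
Qed.
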